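(* Let $m,n$ be positive integers and let $\mathscr{P}_{n,m}=\mathscr{P}_n\times\mathbb{R}^{(m,n)}$, where $\mathscr{P}_n=\{Y\in\mathbb{R}^{(n,n)}: Y={}^tY>0\}$. Use coordinates $(Y,V)$ with $Y=(y_{ij})$ symmetric ($y_{ij}=y_{ji}$) and $V=(v_{kl})\in\mathbb{R}^{(m,n)}$, and set $$\frac{\partial}{\partial Y}=\left(\frac{1+\delta_{ij}}{2}\frac{\partial}{\partial y_{ij}}\right)_{1\le i,j\le n},\qquad \frac{\partial}{\partial V}=\left(\frac{\partial}{\partial v_{kl}}\right)_{1\le k\le m,\ 1\le l\le n}.$$ Define the differential operators on $\mathscr{P}_{n,m}$ $$D_j=\mathrm{Tr}\left(\left(2Y\frac{\partial}{\partial Y}\right)^j\right),\quad 1\le j\le n,$$ $$\Omega^{(0)}_{pq}=\left\{\frac{\partial}{\partial V}\,Y\,{}^t\!\left(\frac{\partial}{\partial V}\right)\right\}_{pq},\quad 1\le p\le q\le m,$$ where $\{M\}_{pq}$ denotes the $(p,q)$-entry of a matrix $M$. Then $$[D_i,D_j]=0\ \text{ for all } 1\le i,j\le n,$$ $$[\Omega^{(0)}_{kl},\Omega^{(0)}_{pq}]=0\ \text{ for all } 1\le k\le l\le m,\ 1\le p\le q\le m,$$ $$[D_1,\Omega^{(0)}_{pq}]=2\,\Omega^{(0)}_{pq}\ \text{ for all } 1\le p\le q\le m,$$ where $[A,B]=AB-BA$.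
   Context: These operators are invariant under the action of $GL(n,\mathbb{R})\ltimes\mathbb{R}^{(m,n)}$ on $\mathscr{P}_{n,m}$ given by $(A,a)\cdot(Y,V)=(AY\,{}^tA,(V+a)\,{}^tA)$. In the definition of $D_j$, the matrix $2Y\frac{\partial}{\partial Y}$ is a matrix of first-order differential operators (entries $\sum_k 2y_{ik}\frac{1+\delta_{kj}}{2}\frac{\partial}{\partial y_{kj}}$), its $j$-th power is the matrix product of operator-valued matrices, and $\mathrm{Tr}$ is the trace. Similarly $\frac{\partial}{\partial V}\,Y\,{}^t(\frac{\partial}{\partial V})$ is the $m\times m$ matrix of operators with $(p,q)$-entry $\sum_{a,b} y_{ab}\frac{\partial^2}{\partial v_{pa}\partial v_{qb}}$. *)

(* Defs.v *)
From HB Require Import structures.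
From mathcomp Require Import all_boot all_order all_algebra.
From mathcomp Require Import all_classical all_reals all_analysis.
Set Implicit Arguments. Unset Strict Implicit. Unset Printing Implicit Defensive.
Import Order.TTheory GRing.Theory Num.Theory.
Import numFieldNormedType.Exports.
Local Open Scope classical_set_scope.
Local Open Scope ring_scope.

Section Siegel.
Variables (R : realType) (n m : nat).

Definition X := ('M[R]_n * 'M[R]_(m, n))%type.

Definition posdef (Y : 'M[R]_n) : Prop :=
  Y^T = Y /\ forall v : 'rV[R]_n, v != 0 -> 0 < (v *m Y *m v^T) 0 0.

Definition Pnm : set X := [set p | posdef p.1].

Definition tangent : set X := [set v | v.1^T = v.1].

Fixpoint iter_deriv (ds : seq X) (f : X -> R) : X -> R :=
  match ds with
  | [::] => f
  | d :: ds' => fun x => derive (iter_deriv ds' f) x d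
  end.

Definition smooth_on_Pnm (f : X -> R) : Prop :=
  forall ds : seq X, all (fun d => `[< tangent d >]) ds ->
    {within Pnm, continuous (iter_deriv ds f)} /\
    forall x d, Pnm x -> tangent d -> derivable (iter_deriv ds f) x d.

(* (1 + delta_ij)/2 d/dy_ij  =  derivative in direction (E_ij + E_ji)/2 *)
Definition dirY (i j : 'I_n) : X := (2^-1 *: (delta_mx i j + delta_mx j i), 0).
Definition dirV (k : 'I_m) (l : 'I_n) : X := (0, delta_mx k l).

Definition pd (v : X) (f : X -> R) : X -> R := fun x => derive f x v.

Definition opA (i l : 'I_n) (f : X -> R) : X -> R :=
  fun x => 2 * \sum_(k < n) x.1 i k * pd (dirY k l) f x.

Fixpoint opPow (j : nat) (i k : 'I_n) (f : X -> R) : X -> R :=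
  match j with
  | 0 => if i == k then f else (fun _ => 0)
  | j'.+1 => fun x => \sum_(l < n) opA i l (opPow j' l k f) x
  end.

Definition Dop (j : nat) (f : X -> R) : X -> R :=
  fun x => \sum_(i < n) opPow j i i f x.

Definition Omega0 (p q : 'I_m) (f : X -> R) : X -> R :=
  fun x => \sum_(a < n) \sum_(b < n) x.1 a b * pd (dirV p a) (pd (dirV q b) f) x.

Definition commut (A B : (X -> R) -> (X -> R)) (f : X -> R) : X -> R :=
  fun x => A (B f) x - B (A f) x.

End Siegel.

(* Main.v *)
Require Import Defs.
From HB Require Import structures.
From mathcomp Require Import all_boot all_order all_algebra.
From mathcomp Require Import all_classical all_reals all_analysis.
From mathcomp Require Import ring lra.
Set Implicit Arguments. Unset Strict Implicit. Unset Printing Implicit Defensive.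
Import Order.TTheory GRing.Theory Num.Theory.
Import numFieldNormedType.Exports.
Local Open Scope ring_scope.

(* On Pnm the operators E_il = 2 sum_k y_ik d_kl satisfy the gl_n relations
   [E_il, E_jp] = delta_lj E_ip - delta_ip E_jl.  Hence
   [E_il, (E^j)_pq] = delta_lp (E^j)_iq - delta_iq (E^j)_pl, so that the traces
   D_j of the powers of E commute with every E_il, and with each other.  The
   operators Omega_pq have coefficients free of V, so they commute because mixed
   partial derivatives do; D_1 is twice the Euler field in Y, of which the
   entries of Y are eigenfunctions.  As Pnm is only relatively open among the
   pairs with symmetric first component, derivatives are taken along lines in
   tangent directions, which stay in Pnm for small times. *)

Lemma sum_continuous (R : realType) (T : topologicalType) (I : finType)
    (F : I -> T -> R) :
  (forall i, continuous (F i)) -> continuous (fun x => \sum_i F i x).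
Proof.
by move=> F_cont; apply: continuous_big => [|i _] //; exact: add_continuous.
Qed.

(** * Openness of positive definiteness among symmetric matrices *)

Section PositiveDefinite.
Local Open Scope classical_set_scope.
Variables (R : realType) (n : nat).
Implicit Types (Y S : 'M[R]_n) (v w : 'rV[R]_n).

Lemma ler_mx_coord p q (M : 'M[R]_(p, q)) i j : `|M i j| <= `|M|.
Proof.
rewrite [leRHS]mx_normrE.
exact: (@le_bigmax _ _ _ 0 (fun ij => `|M ij.1 ij.2|) (i, j)).
Qed.

Definition qform Y v : R := (v *m Y *m v^T) 0 0.

Lemma qformE Y v : qform Y v = \sum_j (\sum_i v 0 i * Y i j) * v 0 j.
Proof. by rewrite /qform mxE; apply: eq_bigr => j _; rewrite !mxE. Qed.

Lemma qformD Y S v : qform (Y + S) v = qform Y v + qform S v.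
Proof. by rewrite /qform mulmxDr mulmxDl mxE. Qed.

Lemma qformZ Y a v : qform Y (a *: v) = a ^+ 2 * qform Y v.
Proof. by rewrite /qform linearZ /= -!scalemxAl -scalemxAr scalerA mxE expr2. Qed.

Lemma qform_continuous Y : continuous (qform Y).
Proof.
rewrite (_ : qform Y = fun v => \sum_j (\sum_i v 0 i * Y i j) * v 0 j);
  last by apply/funext => v; rewrite qformE.
apply: sum_continuous => j w; apply: continuousM; last exact: coord_continuous.
apply: sum_continuous => i u; apply: continuousM; first exact: coord_continuous.
exact: cst_continuous.
Qed.

(** The matrix norm is the largest absolute value of an entry, so each of the [n * n] terms of the
    form is at most [|S|]. *)
Lemma qform_le S v : `|v| = 1 -> `|qform S v| <= (n * n)%:R * `|S|.
Proof.
move=> v1; rewrite qformE.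
have c1 i : `|v 0 i| <= 1 by rewrite -v1 ler_mx_coord.
apply: le_trans (ler_norm_sum _ _ _) _.
apply: (@le_trans _ _ (\sum_(j < n) \sum_(i < n) `|S|)); last first.
  by rewrite !sumr_const card_ord -mulrnA mulr_natl.
apply: ler_sum => j _; rewrite normrM -[leRHS]mulr1 ler_pM//.
apply: le_trans (ler_norm_sum _ _ _) _; apply: ler_sum => i _.
by rewrite normrM -[leRHS]mul1r ler_pM// ler_mx_coord.
Qed.

(** By compactness the form of [Y] has a positive minimum on the unit sphere. A small enough [S]
    cannot cancel it there, and homogeneity of degree 2 extends positivity to all nonzero
    vectors. *)
Lemma posdef_open Y : posdef Y ->
  exists2 e : R, 0 < e & forall S, S^T = S -> `|S| < e -> posdef (Y + S).
Proof.
move=> [Ysym Ypos].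
pose A := [set v : 'rV[R]_n | `|v| = 1].
have unit_of v : v != 0 -> A (`|v|^-1 *: v).
  move=> v0; rewrite /A /= normrZ normfV normr_id mulVf //.
  by rewrite normr_eq0.
(* An empty sphere means that there is no nonzero vector, so any radius works. *)
have [A0|A0] := pselect (A !=set0); last first.
  exists 1 => // S Ssym _; split; first by rewrite linearD /= Ysym Ssym.
  by move=> v v0; exfalso; apply: A0; eexists; apply: unit_of v0.
have cA : compact A.
  apply: bounded_closed_compact.
    by exists 1; split => // r r1 v /= ->; exact: ltW.
  rewrite (_ : A = (fun v => `|v|) @^-1` [set 1 : R]) //.
  apply: closed_comp; last exact: closed_eq.
  by move=> v _; exact: norm_continuous.
have [c cA' cmin] := EVT_min_rV A0 cA (continuous_subspaceT (@qform_continuous Y)).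
move: cA'; rewrite inE => cA'.
have c0 : c != 0 by rewrite -normr_eq0 cA' oner_neq0.
have qc : 0 < qform Y c by exact: Ypos.
have k0 : 0 < (n * n).+1%:R :> R by rewrite ltr0n.
(* The radius is chosen to make the bound of [qform_le] smaller than the minimum; the successor
   keeps the denominator positive. *)
exists (qform Y c / (n * n).+1%:R) => [|S Ssym SE]; first exact: divr_gt0.
split; first by rewrite linearD /= Ysym Ssym.
move=> v v0; have v0' : 0 < `|v| by rewrite normr_gt0.
have Aw := unit_of _ v0; set w := _ *: v in Aw.
have -> : v = `|v| *: w by rewrite scalerA divff ?scale1r // gt_eqF.
rewrite -/(qform _ _) qformZ mulr_gt0 ?exprn_gt0 // qformD.
have := cmin w; rewrite inE => /(_ Aw) le1.
have := qform_le S Aw => le2.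
have : (n * n)%:R * `|S| <= (n * n).+1%:R * `|S|.
  by rewrite ler_wpM2r // ler_nat.
move: SE; rewrite ltr_pdivlMr // mulrC => lt3 le4.
have := ler_norm (- qform S w); rewrite normrN.
lra.
Qed.

End PositiveDefinite.

(** The two difference quotients are the same function of [h]. Passing to one real variable gives
    access to locality on the line and to the mean value theorem. *)
Lemma derivable_line (R : realType) (V : normedModType R) (f : V -> R)
    (y u : V) (s : R) :
  derivable f (s *: u + y) u <-> derivable (fun t : R => f (t *: u + y)) s 1.
Proof.
rewrite /derivable; set q1 := fun h => _; set q2 := fun h => h^-1 *: (_ - f _).
suff -> : q1 = q2 by [].
by apply/funext => h; rewrite /q1 /q2 /= scalerDl [h *: 1]mulr1 addrA.
Qed.

Lemma derive_line (R : realType) (V : normedModType R) (f : V -> R)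
    (y u : V) (s : R) :
  'D_u f (s *: u + y) = 'D_1 (fun t : R => f (t *: u + y)) s.
Proof.
rewrite /derive; set q1 := fun h => _; set q2 := fun h => h^-1 *: (_ - f _).
suff -> : q1 = q2 by [].
by apply/funext => h; rewrite /q1 /q2 /= scalerDl [h *: 1]mulr1 addrA.
Qed.

(** * Locality, smoothness and symmetry of derivatives in tangent directions *)

Section SmoothCalculus.
Local Open Scope classical_set_scope.
Variables (R : realType) (n m : nat).
Local Notation X := (X R n m).
Local Notation P := (@Pnm R n m).
Implicit Types (f g : X -> R) (x d u v : X).

Lemma tangentZ (a : R) d : tangent d -> tangent (a *: d).
Proof. by rewrite /tangent /= => dT; rewrite linearZ /= dT. Qed.

Lemma tangentD u v : tangent u -> tangent v -> tangent (u + v).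
Proof. by rewrite /tangent /= => uT vT; rewrite linearD /= uT vT. Qed.

Lemma Pnm_open x : P x ->
  exists2 e : R, 0 < e & forall d, tangent d -> `|d| < e -> P (d + x).
Proof.
move=> /posdef_open [e e0 He]; exists e => // d dT de.
rewrite /Pnm /= addrC; apply: He => //; apply: le_lt_trans de.
by rewrite [leRHS]prod_normE le_max lexx.
Qed.

(** Provides the small parallelograms on which second differences are formed, and, with one
    coefficient zero, the small segments used for locality. *)
Lemma Pnm_plane x u v (e : R) : tangent u -> tangent v -> 0 < e -> P x ->
  exists2 r : R, 0 < r & forall s t : R, `|s| < r -> `|t| < r ->
    P (s *: u + (t *: v + x)) /\ `|s *: u + t *: v| < e.
Proof.
move=> uT vT e0 Px; have [e' e'0 He] := Pnm_open Px.
(* The summand 1 makes [c] positive even when [u] and [v] vanish, and makes the final estimate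
   strict. *)
pose c := `|u| + `|v| + 1.
have c0 : 0 < c by rewrite /c ltr_wpDl // addr_ge0.
exists (Num.min e e' / c) => [|s t sr tr].
  by rewrite divr_gt0 // lt_min e0.
have : `|s *: u + t *: v| < Num.min e e'.
  apply: le_lt_trans (ler_normD _ _) _; rewrite !normrZ.
  move: sr tr; rewrite !ltr_pdivlMr // => sr tr.
  have su : `|s| * `|u| <= Num.min e e' / c * `|u|.
    by rewrite ler_wpM2r // ler_pdivlMr // ltW.
  have tv : `|t| * `|v| <= Num.min e e' / c * `|v|.
    by rewrite ler_wpM2r // ler_pdivlMr // ltW.
  apply: le_lt_trans (lerD su tv) _; rewrite -mulrDr mulrAC ltr_pdivrMr //.
  by rewrite ltr_pM2l ?lt_min ?e0 // /c ltrDl.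
rewrite lt_min => /andP[h1 h2]; split => //.
by rewrite addrA; apply: He => //; apply: tangentD; apply: tangentZ.
Qed.

Definition eq_on_P f g := forall x, P x -> f x = g x.

Lemma near_line f g x d : eq_on_P f g -> P x -> tangent d ->
  \forall t \near (0 : R), f (t *: d + x) = g (t *: d + x).
Proof.
move=> fg Px dT; have [r r0 H] := Pnm_plane dT dT ltr01 Px.
near=> t; apply: fg.
have tr : `|t| < r by near: t; exists r => // s /=; rewrite sub0r normrN.
have [] := H t 0 tr; first by rewrite normr0.
by rewrite scale0r add0r.
Unshelve. all: by end_near. Qed.

Lemma eq_on_P_derivable f g x d : eq_on_P f g -> P x -> tangent d ->
  derivable f x d -> derivable g x d.
Proof.
move=> fg Px dT; rewrite -{1 2}[x]add0r -(scale0r d) !derivable_line.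
exact/near_eq_derivable/near_line.
Qed.

(** A tangent line through a point of [P] stays in [P] for small times, so the derivative sees only
    values on [P]. This justifies rewriting under an operator with identities valid on [P] only. *)
Lemma eq_on_P_pd f g x d : eq_on_P f g -> P x -> tangent d ->
  pd d f x = pd d g x.
Proof.
move=> fg Px dT; rewrite /pd -{1 2}[x]add0r -(scale0r d) !derive_line.
exact/near_eq_derive/near_line.
Qed.

(** Grading by the order of differentiation, with the first derivative peeled off, gives the
    induction needed for sums and products. *)
Fixpoint Ck (k : nat) f : Prop :=
  {within P, continuous f} /\
  if k is k'.+1 then forall d, tangent d ->
    (forall x, P x -> derivable f x d) /\ Ck k' (pd d f)
  else True.

Definition smooth f := forall k, Ck k f.

Lemma Ck_continuous k f : Ck k f -> {within P, continuous f}.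
Proof. by case: k => [|k] []. Qed.

Lemma CkW k f : Ck k.+1 f -> Ck k f.
Proof.
elim: k f => [|k IHk] f [fc fd]; first by [].
by split=> // d /fd[fD /IHk].
Qed.

Lemma eq_on_P_continuous f g : eq_on_P f g ->
  {within P, continuous f} -> {within P, continuous g}.
Proof.
by move=> fg; apply: subspace_eq_continuous => x; rewrite inE => /fg.
Qed.

Lemma eq_on_P_Ck k f g : eq_on_P f g -> Ck k f -> Ck k g.
Proof.
elim: k f g => [|k IHk] f g fg [fc fd]; split=> //;
  try exact: eq_on_P_continuous fg _.
move=> d dT; have [fD fk] := fd d dT; split=> [x Px|].
  exact: eq_on_P_derivable fg Px dT (fD x Px).
by apply: IHk fk => x Px; exact: eq_on_P_pd.
Qed.

Lemma pdD d f g x : derivable f x d -> derivable g x d ->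
  pd d (fun y => f y + g y) x = pd d f x + pd d g x.
Proof. by move=> fD gD; rewrite /pd -deriveD. Qed.

Lemma pdM d f g x : derivable f x d -> derivable g x d ->
  pd d (fun y => f y * g y) x = f x * pd d g x + g x * pd d f x.
Proof. by move=> fD gD; rewrite /pd (deriveM fD gD). Qed.

Lemma CkD k f g : Ck k f -> Ck k g -> Ck k (fun x => f x + g x).
Proof.
elim: k f g => [|k IHk] f g [fc fd] [gc gd];
  (split; first exact: within_continuousD); first by [].
move=> d dT; have [fD fk] := fd d dT; have [gD gk] := gd d dT; split=> [x Px|].
  by apply: derivableD; auto.
apply: eq_on_P_Ck (IHk _ _ fk gk) => x Px.
by rewrite pdD; auto.
Qed.

Lemma within_continuousM f g : {within P, continuous f} ->
  {within P, continuous g} -> {within P, continuous (fun x => f x * g x)}.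
Proof. by move=> fc gc x; apply: cvgM; [exact: fc|exact: gc]. Qed.

(** In the Leibniz rule one factor remains undifferentiated, so the induction needs it at order [k];
    [CkW] supplies this. *)
Lemma CkM k f g : Ck k f -> Ck k g -> Ck k (fun x => f x * g x).
Proof.
elim: k f g => [|k IHk] f g fk1 gk1.
  by split=> //; apply: within_continuousM; [case: fk1|case: gk1].
split; first by apply: within_continuousM; [case: fk1|case: gk1].
move=> d dT; have [fD fk] := fk1.2 d dT; have [gD gk] := gk1.2 d dT.
split=> [x Px|]; first by apply: derivableM; auto.
apply: eq_on_P_Ck (CkD (IHk _ _ (CkW fk1) gk) (IHk _ _ (CkW gk1) fk)) => x Px.
by rewrite pdM; auto.
Qed.

Lemma Ck_cst k (a : R) : Ck k (fun=> a).
Proof.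
elim: k a => [|k IHk] a; split=> //; try exact: cst_continuous.
move=> d dT; split=> [x Px|]; first exact: derivable_cst.
rewrite (_ : pd d _ = fun=> 0) //.
by apply/funext => x; rewrite /pd derive_cst.
Qed.

Lemma is_derive_coord (i j : 'I_n) x d :
  is_derive x d (fun y : X => y.1 i j) (d.1 i j).
Proof.
suff H : (fun h : R => h^-1 *: (((fun y : X => y.1 i j) \o shift x) (h *: d)
     - x.1 i j)) @ 0^' --> d.1 i j.
  by split; [apply/cvg_ex; exists (d.1 i j)|exact: cvg_lim].
(* A coordinate is linear, so its difference quotient is constant for [h != 0]. *)
apply: cvg_near_cst; near=> h.
have h0 : h != 0 by near: h; exact: nbhs_dnbhs_neq.
by rewrite /= !mxE addrK; exact: mulKf.
Unshelve. all: by end_near. Qed.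

Lemma coordY_continuous (i j : 'I_n) :
  {within P, continuous (fun y : X => y.1 i j)}.
Proof.
apply: continuous_subspaceT => x.
apply: (@continuous_comp _ _ _ fst (fun M : 'M[R]_n => M i j)).
  exact: cvg_fst.
exact: coord_continuous.
Qed.

Lemma Ck_coordY k (i j : 'I_n) : Ck k (fun y : X => y.1 i j).
Proof.
case: k => [|k]; split=> //; try exact: coordY_continuous.
move=> d dT; split=> [x Px|]; first by case: (is_derive_coord i j x d).
rewrite (_ : pd d _ = fun=> d.1 i j); first exact: Ck_cst.
by apply/funext => x; have /@derive_val := is_derive_coord i j x d.
Qed.

(** [iter_deriv] applies the head of its list last, so differentiating [f] first along [d] amounts
    to appending [d] at the end of the list. *)
Lemma smooth_on_Pnm_smooth f : smooth_on_Pnm f -> smooth f.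
Proof.
move=> fS k; elim: k f fS => [|k IHk] f fS; split=> //; try exact: (fS [::] isT).1.
move=> d dT; split=> [x Px|]; first exact: (fS [::] isT).2.
apply: IHk => ds dsT.
have -> : iter_deriv ds (pd d f) = iter_deriv (rcons ds d) f.
  by elim: ds {dsT} => //= e ds ->.
by apply: fS; rewrite all_rcons dsT andbT; exact/asboolP.
Qed.

Lemma smooth_derivable f x d : smooth f -> P x -> tangent d -> derivable f x d.
Proof. by move=> /(_ 1%N)[_ fD] Px dT; exact: (fD d dT).1. Qed.

Lemma smooth_pd f d : smooth f -> tangent d -> smooth (pd d f).
Proof. by move=> fS dT k; have [_ /(_ d dT)[]] := fS k.+1. Qed.

Lemma smooth_cst (a : R) : smooth (fun=> a).
Proof. by move=> k; exact: Ck_cst. Qed.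

Lemma smooth_coordY (i j : 'I_n) : smooth (fun y : X => y.1 i j).
Proof. by move=> k; exact: Ck_coordY. Qed.

Lemma smoothD f g : smooth f -> smooth g -> smooth (fun x => f x + g x).
Proof. by move=> fS gS k; exact: CkD. Qed.

Lemma smoothM f g : smooth f -> smooth g -> smooth (fun x => f x * g x).
Proof. by move=> fS gS k; exact: CkM. Qed.

Lemma smooth_sum (I : finType) (F : I -> X -> R) :
  (forall i, smooth (F i)) -> smooth (fun x => \sum_i F i x).
Proof.
move=> FS; elim: (index_enum I) => [|i s IHs].
  under [fun x => _]funext do rewrite big_nil; exact: smooth_cst.
under [fun x => _]funext do rewrite big_cons; exact: smoothD.
Qed.

Lemma pd_sum (I : finType) (F : I -> X -> R) d x :
  (forall i, smooth (F i)) -> P x -> tangent d ->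
  pd d (fun y => \sum_i F i y) x = \sum_i pd d (F i) x.
Proof.
move=> FS Px dT.
(* Smoothness of the partial sums is carried along the induction, since the sum rule requires their
   derivability. *)
suff [_] : smooth (fun y => \sum_(i <- index_enum I) F i y) /\
  pd d (fun y => \sum_(i <- index_enum I) F i y) x =
    \sum_(i <- index_enum I) pd d (F i) x by [].
elim: (index_enum I) => [|i s [IHS IHs]].
  rewrite big_nil; under [fun x => _]funext do rewrite big_nil.
  by split; [exact: smooth_cst|rewrite /pd derive_cst].
rewrite big_cons; under [fun x => _]funext do rewrite big_cons.
split; first exact: smoothD.
by rewrite pdD ?IHs //; exact: smooth_derivable.
Qed.


(** * Symmetry of mixed derivatives *)

Lemma within_continuous_dist f x (e : R) : {within P, continuous f} -> P x ->
  0 < e -> exists2 r : R, 0 < r &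
    forall d, P (d + x) -> `|d| < r -> `|f x - f (d + x)| < e.
Proof.
move=> /subspace_continuousP fc Px e0.
have /cvgrPdist_lt /(_ e e0) := fc x Px.
rewrite near_withinE => /nbhs_normP[r r0 H]; exists r => // d dP dr.
by apply: H => //=; rewrite opprD addrC addrNK normrN.
Qed.

Lemma mean_value_line f y u (h : R) : 0 < h ->
  (forall s : R, 0 <= s <= h -> derivable f (s *: u + y) u) ->
  exists2 s : R, 0 < s < h & f (h *: u + y) - f y = h * pd u f (s *: u + y).
Proof.
move=> h0 fD.
have [| |s sh E] := @MVT R (fun s => f (s *: u + y))
    (fun s => pd u f (s *: u + y)) 0 h h0.
- move=> s; rewrite in_itv /= => /andP[s0 sh].
  have /derivable_line sD : derivable f (s *: u + y) u.
    by apply: fD; rewrite !ltW.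
  by split=> //; rewrite /pd derive_line.
- apply: derivable_within_continuous => s; rewrite in_itv /= => sh.
  by apply/derivable_line/fD.
exists s; first by move: sh; rewrite in_itv.
by move: E; rewrite scale0r add0r subr0 mulrC.
Qed.

Lemma derivable_shift f y u v :
  derivable (fun z => f (v + z)) y u = derivable f (v + y) u.
Proof.
rewrite /derivable; set q1 := fun h => _; set q2 := fun h => _ *: (_ - f _).
suff -> : q1 = q2 by [].
by apply/funext => h; rewrite /q1 /q2 /= addrCA.
Qed.

Lemma pd_shift f y u v : pd u (fun z => f (v + z)) y = pd u f (v + y).
Proof.
rewrite /pd /derive; set q1 := fun h => _; set q2 := fun h => _ *: (_ - f _).
suff -> : q1 = q2 by [].
by apply/funext => h; rewrite /q1 /q2 /= addrCA.
Qed.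

(* The second difference of f over the parallelogram spanned by h u and h v is
   h^2 times a mixed derivative at an interior point; its symmetry in u and v
   is what makes mixed derivatives commute. *)
Lemma second_difference f x u v (h : R) : smooth f -> tangent u -> tangent v ->
  0 < h ->
  (forall s t : R, 0 <= s <= h -> 0 <= t <= h -> P (s *: u + (t *: v + x))) ->
  exists s t : R, [/\ 0 < s < h, 0 < t < h &
    f (h *: u + (h *: v + x)) - f (h *: u + x) - f (h *: v + x) + f x =
    h * (h * pd v (pd u f) (t *: v + (s *: u + x)))].
Proof.
move=> fS uT vT h0 HP.
have h0h : 0 <= h <= h by rewrite lexx ltW.
have h00 : (0 : R) <= 0 <= h by rewrite lexx ltW.
have fD s t : 0 <= s <= h -> 0 <= t <= h ->
    derivable f (t *: v + (s *: u + x)) u.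
  by move=> sh th; apply: smooth_derivable => //; rewrite addrCA; exact: HP.
have f0 s : 0 <= s <= h -> derivable f (s *: u + x) u.
  by move=> sh; have := fD s 0 sh h00; rewrite scale0r add0r.
have [|s sh E] := @mean_value_line (fun y => f (h *: v + y) - f y) x u h h0.
  move=> s sh; apply: derivableB; last exact: f0.
  by rewrite derivable_shift; exact: fD.
have sh' : 0 <= s <= h by case/andP: sh => ? ?; rewrite !ltW.
have [|t th E'] := @mean_value_line (pd u f) (s *: u + x) v h h0.
  move=> t th; apply: smooth_derivable => //; first exact: smooth_pd.
  by rewrite addrCA; exact: HP.
exists s, t; split=> //; rewrite -E' -pd_shift.
move: E; rewrite {1}/pd deriveB; last 2 first.
- by rewrite derivable_shift; exact: fD.
- exact: f0.
by rewrite /pd => <-; rewrite addrCA; ring.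
Qed.

(** If the mixed derivatives differed by [D > 0] in absolute value at [x], continuity would keep
    each within [D / 2] of its value at [x] on a small parallelogram. Yet the second difference,
    evaluated in both orders, yields two points there at which they take a common value. *)
Lemma pd_comm f x u v : smooth f -> tangent u -> tangent v -> P x ->
  pd u (pd v f) x = pd v (pd u f) x.
Proof.
move=> fS uT vT Px; apply/eqP; rewrite -subr_eq0 -normr_eq0.
apply: contraT => D0; set D := `|_| in D0.
have {}D0 : 0 < D / 2 by rewrite divr_gt0 // lt_neqAle eq_sym D0 normr_ge0.
have cuv : {within P, continuous (pd u (pd v f))}.
  by apply: (@Ck_continuous 0); apply: smooth_pd => //; exact: smooth_pd.
have cvu : {within P, continuous (pd v (pd u f))}.
  by apply: (@Ck_continuous 0); apply: smooth_pd => //; exact: smooth_pd.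
have [r1 r10 H1] := within_continuous_dist cuv Px D0.
have [r2 r20 H2] := within_continuous_dist cvu Px D0.
have [|r r0 Hr] := @Pnm_plane x u v (Num.min r1 r2) uT vT _ Px.
  by rewrite lt_min r10.
have h0 : 0 < r / 2 by rewrite divr_gt0.
have hr s : 0 <= s <= r / 2 -> `|s| < r.
  by case/andP=> s0 sh; rewrite ger0_norm //; lra.
have [|s [t [sh th E]]] := @second_difference f x u v (r / 2) fS uT vT h0.
  by move=> s t /hr sr /hr tr; case: (Hr s t sr tr).
have [|t' [s' [th' sh' E']]] := @second_difference f x v u (r / 2) fS vT uT h0.
  by move=> t' s' /hr tr /hr sr; rewrite addrCA; case: (Hr s' t' sr tr).
have w c : 0 < c < r / 2 -> `|c| < r.
  by case/andP=> c0 c1; apply: hr; rewrite !ltW.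
have [Pst nst] := Hr s t (w _ sh) (w _ th).
have [Pst' nst'] := Hr s' t' (w _ sh') (w _ th').
move: nst nst'; rewrite !lt_min => /andP[_ n2] /andP[n1 _].
move: Pst Pst'; rewrite addrA => Pst; rewrite addrA => Pst'.
have {}H2 := H2 _ Pst n2; have {}H1 := H1 _ Pst' n1.
(* Both sides, multiplied by the square of [r / 2], equal the same second difference of [f]. *)
have EE : pd v (pd u f) (s *: u + t *: v + x) =
          pd u (pd v f) (s' *: u + t' *: v + x).
  have hn : r / 2 != 0 by rewrite gt_eqF.
  apply: (mulfI hn); apply: (mulfI hn).
  rewrite [s *: u + _]addrC -[in LHS]addrA -[in RHS]addrA.
  apply: (etrans (esym E)); apply: etrans E'.
  rewrite [_ *: v + (_ *: u + x)]addrCA.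
  by congr (_ + _); rewrite addrAC.
have key (a b c : R) : `|a - c| < D / 2 -> `|b - c| < D / 2 -> `|a - b| < D.
  move=> ac bc; rewrite [D]splitr; apply: le_lt_trans (ler_distD c a b) _.
  by rewrite [X in _ + X]distrC; exact: ltrD.
by move: H2; rewrite EE => /(key _ _ _ H1); rewrite /D ltxx.
Qed.

End SmoothCalculus.

(** * Commutation relations of the entries of the operator matrix *)

Section GeneralLinearRelations.
Variables (R : realType) (n m : nat).
Local Notation X := (X R n m).
Local Notation P := (@Pnm R n m).
Local Notation dY := (@dirY R n m).
Implicit Types (f g : X -> R) (x : X).

Lemma tangent_dirY (i j : 'I_n) : tangent (dY i j).
Proof. by rewrite /tangent /dirY /= linearZ linearD /= !trmx_delta addrC. Qed.

Lemma tangent_dirV (k : 'I_m) (l : 'I_n) : tangent (dirV R k l).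
Proof. by rewrite /tangent /dirV /= trmx0. Qed.

#[local] Hint Resolve tangent_dirY tangent_dirV : core.

Lemma dirYC (i j : 'I_n) : dY i j = dY j i.
Proof. by rewrite /dirY addrC. Qed.

Lemma PnmC x (i j : 'I_n) : P x -> x.1 i j = x.1 j i.
Proof. by case=> xT _; rewrite -[in LHS]xT mxE. Qed.

Lemma pd_cst d (a : R) x : pd d (fun=> a) x = 0.
Proof. by rewrite /pd derive_cst. Qed.

Lemma pd_coordM d (i j : 'I_n) f x : smooth f -> P x -> tangent d ->
  pd d (fun y => y.1 i j * f y) x = x.1 i j * pd d f x + d.1 i j * f x.
Proof.
move=> fS Px dT.
rewrite pdM; last 2 first.
- by apply: smooth_derivable; first exact: smooth_coordY.
- exact: smooth_derivable.
rewrite [X in _ + X]mulrC; congr (_ + _ * _).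
by have /@derive_val := is_derive_coord i j x d.
Qed.

Lemma smooth_opA (i l : 'I_n) f : smooth f -> smooth (opA i l f).
Proof.
move=> fS; apply: smoothM; first exact: smooth_cst.
apply: smooth_sum => k; apply: smoothM; first exact: smooth_coordY.
exact: smooth_pd.
Qed.

Lemma eq_on_P_opA (i l : 'I_n) f g : eq_on_P f g ->
  eq_on_P (opA i l f) (opA i l g).
Proof.
move=> fg x Px; congr (_ * _); apply: eq_bigr => k _; congr (_ * _).
exact: eq_on_P_pd.
Qed.

Lemma opA_cst (i l : 'I_n) (a : R) x : opA i l (fun=> a) x = 0.
Proof. by rewrite /opA big1 ?mulr0 // => k _; rewrite pd_cst mulr0. Qed.

Lemma opA_sum (I : finType) (F : I -> X -> R) (i l : 'I_n) x :
  (forall r, smooth (F r)) -> P x ->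
  opA i l (fun y => \sum_r F r y) x = \sum_r opA i l (F r) x.
Proof.
move=> FS Px; rewrite /opA -mulr_sumr; congr (_ * _); rewrite exchange_big /=.
by apply: eq_bigr => k _; rewrite pd_sum // mulr_sumr.
Qed.

Lemma opAD (i l : 'I_n) f g x : smooth f -> smooth g -> P x ->
  opA i l (fun y => f y + g y) x = opA i l f x + opA i l g x.
Proof.
move=> fS gS Px; rewrite /opA -mulrDr -big_split /=; congr (_ * _).
by apply: eq_bigr => k _; rewrite pdD ?mulrDr //; exact: smooth_derivable.
Qed.

Lemma opAM (i l : 'I_n) f g x : smooth f -> smooth g -> P x ->
  opA i l (fun y => f y * g y) x = f x * opA i l g x + g x * opA i l f x.
Proof.
move=> fS gS Px; rewrite /opA (mulrCA (f x)) (mulrCA (g x)) -mulrDr.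
congr (_ * _); rewrite !mulr_sumr -big_split /=.
apply: eq_bigr => k _; rewrite pdM; last 2 first.
- exact: smooth_derivable.
- exact: smooth_derivable.
by rewrite mulrDr !(mulrCA (x.1 i k)).
Qed.

Lemma opAZ (i l : 'I_n) (a : R) f x : smooth f -> P x ->
  opA i l (fun y => a * f y) x = a * opA i l f x.
Proof.
by move=> fS Px; rewrite (@opAM i l (fun=> a)) ?opA_cst ?mulr0 ?addr0 //;
  exact: smooth_cst.
Qed.

(* The second-order part of opA i l \o opA j p; it is symmetric under exchange
   of the two operators, so only the first-order terms survive in the bracket. *)
Definition opA2 (i l j p : 'I_n) f x : R :=
  \sum_k \sum_q x.1 i k * (x.1 j q * pd (dY k l) (pd (dY q p) f) x).

Lemma opA2C (i l j p : 'I_n) f x : smooth f -> P x ->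
  opA2 i l j p f x = opA2 j p i l f x.
Proof.
move=> fS Px; rewrite [LHS]exchange_big; apply: eq_bigr => k _.
apply: eq_bigr => q _.
rewrite (pd_comm fS (tangent_dirY q l) (tangent_dirY k p) Px).
exact: mulrCA.
Qed.

(** The product rule also differentiates the coefficient [y_jq] in direction [dY k l], which gives
    half a sum of two Kronecker terms. One collapses to [2 * x.1 i j * pd (dY l p) f x], the other
    to [opA i p f x]. *)
Lemma opA_opA (i l j p : 'I_n) f x : smooth f -> P x ->
  opA i l (opA j p f) x =
    4 * opA2 i l j p f x + 2 * x.1 i j * pd (dY l p) f x + (l == j)%:R * opA i p f x.
Proof.
move=> fS Px.
have S1 q : smooth (fun y : X => y.1 j q * pd (dY q p) f y).
  by apply: smoothM; [exact: smooth_coordY|exact: smooth_pd].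
(* The factor [2^-1] of [dirY] cancels the 2 of the inner operator, leaving Kronecker terms with
   coefficient 1. *)
have -> : opA i l (opA j p f) x = 2 * (2 * opA2 i l j p f x +
    \sum_k \sum_q x.1 i k * (((k == j) && (l == q))%:R +
       ((l == j) && (k == q))%:R) * pd (dY q p) f x).
  rewrite [LHS]/opA; congr (_ * _).
  rewrite /opA2 mulr_sumr -big_split /=; apply: eq_bigr => k _.
  rewrite [X in pd _ X]/opA (@pdM _ _ _ _ (fun=> 2)); last 2 first.
  - by apply: smooth_derivable; first exact: smooth_cst.
  - by apply: smooth_derivable => //; exact: smooth_sum.
  rewrite pd_cst mulr0 addr0 pd_sum // mulrCA !mulr_sumr -big_split /=.
  apply: eq_bigr => q _; rewrite pd_coordM //; last exact: smooth_pd.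
  rewrite /dirY /= !mxE -/(dirY _ _ _ _) ![j == _]eq_sym ![q == _]eq_sym.
  have h2 : 2 * 2^-1 = 1 :> R by rewrite divff.
  set a := pd _ _ _; set b := pd _ f _.
  transitivity (2 * (x.1 i k * (x.1 j q * a)) + x.1 i k * ((2 * 2^-1) *
    (((k == j) && (l == q))%:R + ((l == j) && (k == q))%:R)) * b).
    ring.
  by rewrite h2 mul1r.
rewrite mulrDr mulrA -natrM -addrA; congr (_ + _).
under eq_bigr => k _ do under eq_bigr => q _ do rewrite mulrDr mulrDl.
under eq_bigr => k _ do rewrite big_split /=.
rewrite big_split /= mulrDr; congr (_ + _).
  rewrite (bigD1 j) //= (bigD1 l) //= !eqxx mulr1.
  rewrite big1 ?addr0 => [|q /negPf ql]; last first.
    by rewrite eq_sym ql mulr0 mul0r.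
  rewrite big1 ?addr0 ?mulrA // => k /negPf kj.
  by rewrite big1 // => q _; rewrite kj mulr0 mul0r.
rewrite /opA mulrCA; congr (_ * _); rewrite mulr_sumr; apply: eq_bigr => k _.
rewrite (bigD1 k) //= eqxx andbT big1 ?addr0 => [|q /negPf qk]; last first.
  by rewrite [k == q]eq_sym qk andbF mulr0 mul0r.
by rewrite mulrCA mulrA.
Qed.

(** By symmetry of [Y] and of [dirY], the term [2 * x.1 i j * pd (dY l p) f x] is unchanged under
    exchange of the two operators, as is the second-order part. Only the Kronecker terms survive. *)
Lemma opA_commute (i l j p : 'I_n) f x : smooth f -> P x ->
  opA i l (opA j p f) x = opA j p (opA i l f) x +
    (l == j)%:R * opA i p f x - (i == p)%:R * opA j l f x.
Proof.
move=> fS Px; rewrite (opA_opA i l j p fS Px) (opA_opA j p i l fS Px).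
rewrite (opA2C j p i l fS Px) (PnmC j i Px) (dirYC p l) [p == i]eq_sym.
by rewrite [RHS]addrAC addrK.
Qed.

Lemma smooth_opPow j (p q : 'I_n) f : smooth f -> smooth (opPow j p q f).
Proof.
elim: j p => [|j IHj] p fS /=.
  by case: ifP => // _; exact: smooth_cst.
by apply: smooth_sum => l; apply: smooth_opA; exact: IHj.
Qed.

End GeneralLinearRelations.

(** * Traces of powers as commuting Casimir operators *)

Section Casimir.
Variables (R : realType) (n m : nat).
Local Notation X := (X R n m).
Local Notation P := (@Pnm R n m).
Implicit Types (f g : X -> R) (x : X).

Lemma opPow_sum (I : finType) (F : I -> X -> R) j (p q : 'I_n) x :
  (forall r, smooth (F r)) -> P x ->
  opPow j p q (fun y => \sum_r F r y) x = \sum_r opPow j p q (F r) x.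
Proof.
elim: j p x => [|j IHj] p x FS Px /=.
  by case: ifP => // _; rewrite big1.
rewrite exchange_big /=; apply: eq_bigr => l _.
rewrite -opA_sum //; last by move=> r; exact: smooth_opPow.
by apply: eq_on_P_opA => // y Py; exact: IHj.
Qed.

Lemma sum_delta_l (l : 'I_n) (F : 'I_n -> R) :
  \sum_r (l == r)%:R * F r = F l.
Proof.
rewrite (bigD1 l) //= eqxx mul1r big1 ?addr0 // => r /negPf rl.
by rewrite eq_sym rl mul0r.
Qed.

(** Scalar bookkeeping for the induction step of [opA_opPow]: the Kronecker factors select [b l] and
    [e i], which cancel. *)
Lemma sum_delta_cancel (l i : 'I_n) (F a b c d e : 'I_n -> R) (s t : R) :
  (forall r, F r = a r + (l == r)%:R * b r - t * c r + s * d r -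
     (i == r)%:R * e r) ->
  b l = e i -> \sum_r F r = \sum_r a r + s * (\sum_r d r) - t * \sum_r c r.
Proof.
move=> FE be; under eq_bigr => r _ do rewrite FE.
rewrite sumrB !big_split /= sumrN -!mulr_sumr !sum_delta_l be; ring.
Qed.

(** By induction on [j], [opA i l] is moved past the leading factor [opA p r] by [opA_commute], then
    past the remaining power. The correction at [r = l] from the power and the one at [r = i] from
    the leading factor are both [opA p l (opPow j i q f)], with opposite signs. *)
Lemma opA_opPow j (i l p q : 'I_n) f x : smooth f -> P x ->
  opA i l (opPow j p q f) x = opPow j p q (opA i l f) x +
    (l == p)%:R * opPow j i q f x - (i == q)%:R * opPow j p l f x.
Proof.
elim: j p x => [|j IHj] p x fS Px /=.
  (* The power zero is the identity matrix, for which the two corrections cancel. *)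
  rewrite (fun_if (opA i l)) !(fun_if (fun h : X -> R => h x)) opA_cst.
  rewrite [p == l]eq_sym; case: (l == p); case: (i == q);
    by rewrite ?mul1r ?mul0r ?addr0 ?subr0 ?addrK.
have GS r : smooth (opPow j r q f) by exact: smooth_opPow.
rewrite opA_sum //; last by move=> r; exact: smooth_opA.
apply: (sum_delta_cancel (l := l) (i := i)
    (a := fun r => opA p r (opPow j r q (opA i l f)) x)
    (b := fun r => opA p r (opPow j i q f) x)
    (c := fun r => opA p r (opPow j r l f) x)
    (d := fun r => opA i r (opPow j r q f) x)
    (e := fun r => opA p l (opPow j r q f) x)); last by [].
  move=> r; rewrite (opA_commute i l p r (GS r) Px); congr (_ + _ - _).
  have GS1 : smooth (opPow j r q (opA i l f)).
    by apply: smooth_opPow; exact: smooth_opA.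
  have GS2 (a : R) s : smooth (fun y => a * opPow j s q f y).
    by apply: smoothM => //; exact: smooth_cst.
  have GS3 (a : R) : smooth (fun y => a * opPow j r l f y).
    by apply: smoothM; [exact: smooth_cst|exact: smooth_opPow].
  rewrite (eq_on_P_opA p r (fun y Py => IHj r y fS Py) Px).
  (* Writing the difference as a sum with a negated scalar makes [opAD] and [opAZ] applicable. *)
  under [fun y => _]funext do rewrite -mulNr.
  rewrite opAD //; last exact: smoothD.
  rewrite opAD // !opAZ // ?mulNr //; exact: smooth_opPow.
Qed.

Lemma Dop_sum (I : finType) (F : I -> X -> R) j x :
  (forall r, smooth (F r)) -> P x ->
  Dop j (fun y => \sum_r F r y) x = \sum_r Dop j (F r) x.
Proof.
move=> FS Px; rewrite /Dop exchange_big /=; apply: eq_bigr => i _.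
exact: opPow_sum.
Qed.

(** Summing [opA_opPow] over [p = q], each of the two corrections collapses to [opPow j i l f x], so
    they cancel. *)
Lemma opA_Dop j (i l : 'I_n) f x : smooth f -> P x ->
  opA i l (Dop j f) x = Dop j (opA i l f) x.
Proof.
move=> fS Px; rewrite opA_sum //; last by move=> r; exact: smooth_opPow.
under eq_bigr => p _ do rewrite opA_opPow //.
by rewrite sumrB big_split /= !sum_delta_l addrK.
Qed.

Lemma opPow_Dop i j (p q : 'I_n) f x : smooth f -> P x ->
  opPow i p q (Dop j f) x = Dop j (opPow i p q f) x.
Proof.
elim: i p x => [|i IHi] p x fS Px /=.
  case: ifP => // _.
  (* Off the diagonal the zero function is viewed as an empty sum, so that additivity shows that
     [Dop j] kills it. *)
  have sum0 : (fun y : X => \sum_(r < 0) 0) = (fun=> 0 : R).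
    by apply/funext => y; rewrite big_ord0.
  by rewrite -sum0 Dop_sum ?big_ord0 // => r; exact: smooth_cst.
rewrite Dop_sum //; last first.
  by move=> l; apply: smooth_opA; exact: smooth_opPow.
apply: eq_bigr => l _; rewrite -opA_Dop //; last exact: smooth_opPow.
by apply: eq_on_P_opA => // y Py; exact: IHi.
Qed.

Lemma Dop_comm i j f x : smooth f -> P x ->
  Dop i (Dop j f) x = Dop j (Dop i f) x.
Proof.
move=> fS Px; rewrite [RHS]Dop_sum //; last by move=> p; exact: smooth_opPow.
by apply: eq_bigr => p _; exact: opPow_Dop.
Qed.

End Casimir.

(** * The operators [Omega0] and their bracket with [Dop 1] *)

Section Omega.
Variables (R : realType) (n m : nat).
Local Notation X := (X R n m).
Local Notation P := (@Pnm R n m).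
Implicit Types (f g : X -> R) (x : X).

#[local] Hint Resolve tangent_dirY tangent_dirV : core.

Definition pdV2 (p q : 'I_m) (a b : 'I_n) f : X -> R :=
  pd (dirV R p a) (pd (dirV R q b) f).

Lemma smooth_pdV2 (p q : 'I_m) (a b : 'I_n) f :
  smooth f -> smooth (pdV2 p q a b f).
Proof. by move=> fS; apply: smooth_pd => //; exact: smooth_pd. Qed.

(** A direction [dirV] has zero first component, so entries of [Y] behave as constants. *)
Lemma pdV_coordM (k : 'I_m) (c a b : 'I_n) f x : smooth f -> P x ->
  pd (dirV R k c) (fun y => y.1 a b * f y) x = x.1 a b * pd (dirV R k c) f x.
Proof. by move=> fS Px; rewrite pd_coordM // mxE mul0r addr0. Qed.

Lemma pdV2_coordM (p q : 'I_m) (a b c d : 'I_n) f x : smooth f -> P x ->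
  pdV2 p q a b (fun y => y.1 c d * f y) x = x.1 c d * pdV2 p q a b f x.
Proof.
move=> fS Px; rewrite -pdV_coordM //; last exact: smooth_pd.
by apply: eq_on_P_pd => // y Py; exact: pdV_coordM.
Qed.

Lemma pdV2_sum (I : finType) (F : I -> X -> R) (p q : 'I_m) (a b : 'I_n) x :
  (forall r, smooth (F r)) -> P x ->
  pdV2 p q a b (fun y => \sum_r F r y) x = \sum_r pdV2 p q a b (F r) x.
Proof.
move=> FS Px; rewrite /pdV2 -pd_sum //; last by move=> r; exact: smooth_pd.
by apply: eq_on_P_pd => // y Py; exact: pd_sum.
Qed.

Lemma pdV2_comm (p q k l : 'I_m) (a b c d : 'I_n) f x : smooth f -> P x ->
  pdV2 p q a b (pdV2 k l c d f) x = pdV2 k l c d (pdV2 p q a b f) x.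
Proof.
(* A single derivative crosses [pdV2] by two swaps of mixed derivatives; doing this for each of the
   two outer derivatives gives the claim. *)
have comm1 r e g y : smooth g -> P y ->
    pd (dirV R r e) (pdV2 k l c d g) y = pdV2 k l c d (pd (dirV R r e) g) y.
  move=> gS Py.
  have swap := pd_comm (smooth_pd gS (tangent_dirV R l d))
    (tangent_dirV R r e) (tangent_dirV R k c) Py.
  apply: (etrans swap).
  apply: (eq_on_P_pd _ Py (tangent_dirV R k c)) => z Pz.
  exact: (pd_comm gS (tangent_dirV R r e) (tangent_dirV R l d) Pz).
move=> fS Px; apply: (etrans _ (comm1 p a _ _
  (smooth_pd fS (tangent_dirV R q b)) Px)).
by apply: (eq_on_P_pd _ Px (tangent_dirV R p a)) => y Py; exact: comm1.
Qed.

(** One sum over pairs of indices lets the additivity lemmas apply in a single step. *)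
Lemma Omega0E (p q : 'I_m) f x :
  Omega0 p q f x =
    \sum_(ab : 'I_n * 'I_n) x.1 ab.1 ab.2 * pdV2 p q ab.1 ab.2 f x.
Proof. exact: pair_bigA. Qed.

Lemma smooth_Omega0_term (p q : 'I_m) (a b : 'I_n) f : smooth f ->
  smooth (fun y => y.1 a b * pdV2 p q a b f y).
Proof.
by move=> fS; apply: smoothM; [exact: smooth_coordY|exact: smooth_pdV2].
Qed.

Lemma Omega0_fun (p q : 'I_m) f :
  Omega0 p q f = fun x =>
    \sum_(ab : 'I_n * 'I_n) x.1 ab.1 ab.2 * pdV2 p q ab.1 ab.2 f x.
Proof. by apply/funext => x; exact: Omega0E. Qed.

(** The inner coefficients pass through the [V]-derivatives, so no lower-order terms appear and
    exchanging the two operators only permutes the double sum. *)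
Lemma Omega0_Omega0 (k l p q : 'I_m) f x : smooth f -> P x ->
  Omega0 k l (Omega0 p q f) x =
    \sum_(cd : 'I_n * 'I_n) \sum_(ab : 'I_n * 'I_n)
      x.1 cd.1 cd.2 * (x.1 ab.1 ab.2 *
        pdV2 k l cd.1 cd.2 (pdV2 p q ab.1 ab.2 f) x).
Proof.
move=> fS Px; rewrite Omega0E; apply: eq_bigr => -[c d] _ /=.
rewrite Omega0_fun pdV2_sum //; last by move=> r; exact: smooth_Omega0_term.
rewrite mulr_sumr; apply: eq_bigr => -[a b] _ /=.
by rewrite pdV2_coordM //; exact: smooth_pdV2.
Qed.

Lemma Omega0_comm (k l p q : 'I_m) f x : smooth f -> P x ->
  Omega0 k l (Omega0 p q f) x = Omega0 p q (Omega0 k l f) x.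
Proof.
move=> fS Px; apply: (etrans (Omega0_Omega0 k l p q fS Px)).
apply: (etrans _ (esym (Omega0_Omega0 p q k l fS Px))).
rewrite [LHS]exchange_big; apply: eq_bigr => -[a b] _.
apply: eq_bigr => -[c d] _.
rewrite (pdV2_comm k l p q c d a b fS Px); exact: mulrCA.
Qed.

Lemma Dop1E f x : Dop 1 f x = \sum_i opA i i f x.
Proof.
apply: eq_bigr => i _ /=; rewrite (bigD1 i) //= eqxx big1 ?addr0 // => l li.
by rewrite (negPf li) opA_cst.
Qed.

(** [Dop 1] is of first order without constant term, hence a derivation. *)
Lemma Dop1M f g x : smooth f -> smooth g -> P x ->
  Dop 1 (fun y => f y * g y) x = f x * Dop 1 g x + g x * Dop 1 f x.
Proof.
move=> fS gS Px; rewrite !Dop1E !mulr_sumr -big_split /=.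
by apply: eq_bigr => i _; exact: opAM.
Qed.

Lemma Dop1_coordY (a b : 'I_n) x : P x ->
  Dop 1 (fun y : X => y.1 a b) x = 2 * x.1 a b.
Proof.
move=> Px; rewrite Dop1E /opA -mulr_sumr; congr (_ * _).
have sum_delta2 (F : 'I_n -> 'I_n -> R) (c d : 'I_n) :
    \sum_i \sum_k F i k * ((c == i)%:R * (d == k)%:R) = F c d.
  rewrite -[RHS](sum_delta_l c (fun i => F i d)); apply: eq_bigr => i _.
  rewrite -[in RHS](sum_delta_l d (F i)) mulr_sumr; apply: eq_bigr => k _.
  ring.
(* [F] absorbs the factor [2^-1] of [dirY]; the two Kronecker sums below give half of [x.1 b a] and
   half of [x.1 a b], which agree on [P]. *)
pose F i k : R := x.1 i k / 2.
transitivity (\sum_i \sum_k F i k * ((b == i)%:R * (a == k)%:R) +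
              \sum_i \sum_k F i k * ((a == i)%:R * (b == k)%:R)); last first.
  by rewrite !sum_delta2 /F (PnmC b a Px) -splitr.
rewrite -big_split; apply: eq_bigr => i _; rewrite -big_split.
apply: eq_bigr => k _.
have -> : pd (dirY R m k i) (fun y : X => y.1 a b) x = (dirY R m k i).1 a b.
  by have /@derive_val := is_derive_coord a b x (dirY R m k i).
rewrite /dirY /= !mxE -!natrM !mulnb -mulrDr /F -mulrA.
by rewrite [(b == i) && _]andbC.
Qed.

Lemma opA_pdV (i l : 'I_n) (k : 'I_m) (c : 'I_n) f x : smooth f -> P x ->
  opA i l (pd (dirV R k c) f) x = pd (dirV R k c) (opA i l f) x.
Proof.
move=> fS Px.
have TS j : smooth (fun y : X => y.1 i j * pd (dirY R m j l) f y).
  by apply: smoothM; [exact: smooth_coordY|exact: smooth_pd].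
rewrite {2}/opA (@pdM _ _ _ _ (fun=> 2)); last 2 first.
- by apply: smooth_derivable => //; exact: smooth_cst.
- by apply: smooth_derivable => //; exact: smooth_sum.
rewrite pd_cst mulr0 addr0 pd_sum //; congr (_ * _); apply: eq_bigr => j _.
apply: (etrans _ (esym (pdV_coordM k c i j
  (smooth_pd fS (tangent_dirY R m j l)) Px))).
by rewrite (pd_comm fS (tangent_dirY R m j l) (tangent_dirV R k c) Px).
Qed.

Lemma Dop1_pdV2 (p q : 'I_m) (a b : 'I_n) f x : smooth f -> P x ->
  Dop 1 (pdV2 p q a b f) x = pdV2 p q a b (Dop 1 f) x.
Proof.
have DE g : Dop 1 g = fun y => \sum_i opA i i g y.
  by apply/funext => y; exact: Dop1E.
move=> fS Px; rewrite [RHS](_ : _ = \sum_i pdV2 p q a b (opA i i f) x).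
  rewrite Dop1E; apply: eq_bigr => i _.
  apply: (etrans (opA_pdV i i p a (smooth_pd fS (tangent_dirV R q b)) Px)).
  by apply: (eq_on_P_pd _ Px (tangent_dirV R p a)) => y Py; exact: opA_pdV.
by rewrite DE pdV2_sum // => i; exact: smooth_opA.
Qed.

(** [Dop 1] commutes with the [V]-derivatives, so the derivation rule leaves only its action on the
    coefficients [y_ab], each an eigenfunction of eigenvalue 2. *)
Lemma Dop1_Omega0 (p q : 'I_m) f x : smooth f -> P x ->
  Dop 1 (Omega0 p q f) x = Omega0 p q (Dop 1 f) x + 2 * Omega0 p q f x.
Proof.
move=> fS Px; rewrite {1}Omega0_fun Dop_sum //; last first.
  by move=> r; exact: smooth_Omega0_term.
rewrite !Omega0E mulr_sumr -big_split /=; apply: eq_bigr => -[a b] _ /=.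
rewrite Dop1M //; [|exact: smooth_coordY|exact: smooth_pdV2].
rewrite Dop1_pdV2 // Dop1_coordY //; congr (_ + _).
by rewrite mulrC mulrA.
Qed.

End Omega.

Theorem theorem4p1 (R : realType) (n m : nat) (hn : (0 < n)%N) (hm : (0 < m)%N)
  (f : X R n m -> R) (hf : smooth_on_Pnm f) (x : X R n m) (hx : Pnm x) :
  (forall i j : nat, (1 <= i <= n)%N -> (1 <= j <= n)%N ->
     commut (Dop i) (Dop j) f x = 0) /\
  (forall k l p q : 'I_m, (k <= l)%N -> (p <= q)%N ->
     commut (Omega0 k l) (Omega0 p q) f x = 0) /\
  (forall p q : 'I_m, (p <= q)%N ->
     commut (Dop 1) (Omega0 p q) f x = 2 * Omega0 p q f x).
Proof.
have fS := smooth_on_Pnm_smooth hf.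
split; [|split] => [i j _ _|k l p q _ _|p q _]; apply/eqP.
- by rewrite subr_eq0 (Dop_comm _ _ fS hx).
- by rewrite subr_eq0 (Omega0_comm _ _ _ _ fS hx).
- by rewrite /commut (Dop1_Omega0 _ _ fS hx) addrAC subrr add0r.
Qed.
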